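(* A paracompact space $X$ is $lc^n_G$ if and only if each open cover $\mathcal U$ of $X$ has an open refinement $\mathcal V$ (an open cover of $X$) such that for any two correct $\mathcal V$-close chain morphisms $\varphi,\phi:S^{(n)}(Z;G)\to S(X;G)$, where $Z$ is an arbitrary space, there exists a $\mathcal U$-small chain homotopy $D:S^{(n)}(Z;G)\to S(X;G)$ between $\varphi$ and $\phi$.
   Context: Conventions: all spaces are paracompact, maps are continuous; $G$ is a commutative ring with unit; $n\ge0$ is an integer; $H_k(\cdot;G)$ is singular homology, reduced in dimension $0$. A space $X$ is $lc^n_G$ (homologically locally connected in dimension $n$ with respect to $G$) if for every $x\in X$ every neighborhood $U$ of $x$ contains another neighborhood $V$ of $x$ such that the inclusion induces trivial homomorphisms $H_k(V;G)\to H_k(U;G)$ for all $k\le n$. A chain morphism is a sequence of homomorphisms of $G$-modules (degree by degree) commuting with the boundaries and, in degree $0$, with the augmentations. $S(Z;G)$ is the singular chain complex of $Z$ and $S^{(n)}(Z;G)=\{S_k(Z;G)\}_{k\le n}$. The carrier of a singular simplex $\sigma:\triangle^k\to X$ is $|\sigma|=\sigma(\triangle^k)$; for a chain $c=\sum_i g_i\sigma_i$ (irreducible representation) $|c|=\bigcup_i|\sigma_i|$, and $|0|=\varnothing$. A face of a singular simplex $\sigma$ defined on $\triangle^k$ is the restriction of $\sigma$ to a face of $\triangle^k$; a vertex of $\sigma$ is the singular $0$-simplex obtained by restriction to a vertex of $\triangle^k$. A chain morphism $S^{(n)}(Z;G)\to S(X;G)$ is correct if it sends every singular $0$-simplex of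 $Z$ to a singular $0$-simplex of $X$. For an open cover $\mathcal U$ of $X$, chain morphisms $\varphi,\phi:S^{(n)}(Z;G)\to S(X;G)$ are $\mathcal U$-close if for each singular simplex $\sigma$ of $S^{(n)}(Z;G)$ there is $U_\sigma\in\mathcal U$ with $|\varphi(\tau)|\cup|\phi(\tau)|\subset U_\sigma$ for all faces $\tau$ of $\sigma$. A chain homotopy $D:S^{(n)}(Z;G)\to S(X;G)$ between $\varphi$ and $\phi$ is a sequence of homomorphisms $D_k:S_k(Z;G)\to S_{k+1}(X;G)$, $0\le k\le n$, with $\partial D_0(\sigma)=\varphi(\sigma)-\phi(\sigma)$ for singular $0$-simplexes $\sigma$ and $\partial D_k(\sigma)=\varphi(\sigma)-\phi(\sigma)-D_{k-1}(\partial\sigma)$ for singular $k$-simplexes $\sigma$, $1\le k\le n$. It is $\mathcal U$-small if for every singular simplex $\sigma$ of the domain there is $U_\sigma\in\mathcal U$ with $|D(\tau)|\cup|\varphi(v)|\cup|\phi(v)|\subset U_\sigma$ for all faces $\tau$ and all vertices $v$ of $\sigma$. *)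

(* Defs.v *)
From HB Require Import structures.
From mathcomp Require Import all_boot all_order all_algebra finmap.
(* The notations of monalg clash with those of the analysis library. *)
From mathcomp.multinomials Require Import -(notations) monalg.
From mathcomp Require Import all_classical all_reals topology normedtype.

Set Implicit Arguments.
Unset Strict Implicit.
Unset Printing Implicit Defensive.

Import Order.TTheory GRing.Theory Num.Theory.
Import numFieldNormedType.Exports.

Local Open Scope classical_set_scope.
Local Open Scope quotient_scope.
Local Open Scope ring_scope.

Definition open_cover (X : topologicalType) (U : set (set X)) :=
  (forall A, U A -> open A) /\ \bigcup_(A in U) A = [set: X].

Definition refines (X : Type) (V U : set (set X)) :=
  forall B, V B -> exists2 A, U A & B `<=` A.

Definition locally_finite (X : topologicalType) (V : set (set X)) :=
  forall x : X, exists2 N, nbhs x N &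
    finite_set [set B | V B /\ B `&` N !=set0].

Definition paracompact (X : topologicalType) :=
  hausdorff_space X /\
  forall U : set (set X), open_cover U ->
    exists V, [/\ open_cover V, refines V U & locally_finite V].

Section Simplex.
Variable R : realType.

Definition simplex_set (k : nat) : set 'rV[R]_k.+1 :=
  [set t | (forall i, 0 <= t 0 i) /\ \sum_i t 0 i = 1].

(* The topology is the one induced by 'rV[R]_k.+1. *)
Definition simplex (k : nat) : Type := set_type (@simplex_set k).

HB.instance Definition _ k := Topological.on (simplex k).

(* The affine map between standard simplexes sending the i-th vertex to the
   (f i)-th one. *)
Definition vertex_row m k (f : 'I_m.+1 -> 'I_k.+1) (t : 'rV[R]_m.+1) :
    'rV[R]_k.+1 :=
  \row_j \sum_(i | f i == j) t 0 i.

Lemma vertex_row_simplex m k (f : 'I_m.+1 -> 'I_k.+1) (t : simplex m) :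
  vertex_row f (set_val t) \in @simplex_set k.
Proof.
have [t_ge0 t_sum] := set_valP t.
apply: mem_set; split=> [j|]; first by rewrite mxE sumr_ge0.
under eq_bigr do rewrite mxE.
by rewrite -[RHS]t_sum [RHS](partition_big f xpredT).
Qed.

Definition vertex_map_fun m k (f : 'I_m.+1 -> 'I_k.+1) (t : simplex m) :
    simplex k :=
  exist _ (vertex_row f (set_val t)) (vertex_row_simplex f t).

Lemma vertex_map_continuous m k (f : 'I_m.+1 -> 'I_k.+1) :
  continuous (vertex_map_fun f).
Proof.
apply: continuous_comp_initial => t A [P nP sPA].
have ct j : continuous (fun u : simplex m => vertex_row f (set_val u) 0 j).
  rewrite /vertex_row; under eq_fun do rewrite mxE.
  apply: continuous_big => [|i _].
    by move=> z; exact: (@add_continuous R^o).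
  move=> u; apply: (@continuous_comp _ _ _ (set_val : simplex m -> _)
    (fun v : 'rV[R]_m.+1 => v 0 i)).
    exact: initial_continuous.
  exact: coord_continuous.
have nt : \forall u \near t, forall j, P 0 j (vertex_row f (set_val u) 0 j).
  apply: (@filter_forall _ _ (fun j (u : simplex m) =>
    P 0 j (vertex_row f (set_val u) 0 j)) (nbhs t) (@nbhs_filter _ t)) => j.
  by apply: ct; exact: nP.
by apply: filterS nt => u Pu; apply: sPA => i j; rewrite ord1; exact: Pu.
Qed.

Definition vertex_map m k (f : 'I_m.+1 -> 'I_k.+1) :
    continuousType (simplex m) (simplex k) :=
  mkcts (@vertex_map_continuous m k f).

Definition sing (k : nat) (X : topologicalType) :=
  continuousType (simplex k) X.

Definition sing_restr (X : topologicalType) m k (f : 'I_m.+1 -> 'I_k.+1)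
    (s : sing k X) : sing m X :=
  (s \o vertex_map f)%FUN.

Definition sing_push (X Y : topologicalType) (f : continuousType X Y) k
    (s : sing k X) : sing k Y :=
  (f \o s)%FUN.

(* A face of the standard k-simplex is given by the increasing list of its
   vertices; the faces include the simplex itself. *)
Definition is_face (X : topologicalType) m k (t : sing m X) (s : sing k X) :=
  exists2 f : 'I_m.+1 -> 'I_k.+1, {homo f : i j / (i < j)%N} &
    t = sing_restr f s.

Definition is_vertex (X : topologicalType) k (v : sing 0 X) (s : sing k X) :=
  is_face v s.

End Simplex.

Arguments is_vertex {R X k} v s.

Section Chains.
Variables (R : realType) (G : comPzRingType).
Implicit Types (X Y : topologicalType) (k : nat).

Definition chain k X := malg (sing R k X) G.

HB.instance Definition _ k X := GRing.Zmodule.on (chain k X).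

Section Module.
Variables (k : nat) (X : topologicalType).
Implicit Types (c : chain k X) (s : sing R k X) (a b : G).

(* The library makes [malg] a module over nontrivial rings only. *)
Definition chain_scale a c : chain k X :=
  \sum_(s <- msupp c) mkmalgU s (a * mcoeff s c).

Lemma chain_scaleE a c s : mcoeff s (chain_scale a c) = a * mcoeff s c.
Proof.
rewrite raddf_sum /=; under eq_bigr do rewrite mcoeffU.
case: msuppP => [s_c|s_c].
  rewrite (big_fsetD1 s) //= eqxx mulr1n big_seq big1 ?addr0 // => t.
  by rewrite in_fsetD1 => /andP[/negPf -> _]; rewrite mulr0n.
rewrite mulr0 big_seq big1 // => t t_c.
by case: eqP s_c => [<-|]; rewrite ?t_c ?mulr0n.
Qed.

Lemma chain_scaleA a b c :
  chain_scale a (chain_scale b c) = chain_scale (a * b) c.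
Proof. by apply/malgP => s; rewrite !chain_scaleE mulrA. Qed.

Lemma chain_scale1 : left_id 1 chain_scale.
Proof. by move=> c; apply/malgP => s; rewrite chain_scaleE mul1r. Qed.

Lemma chain_scaleDr : right_distributive chain_scale +%R.
Proof.
by move=> a c d; apply/malgP => s; rewrite mcoeffD !chain_scaleE mcoeffD mulrDr.
Qed.

Lemma chain_scaleDl c : {morph chain_scale^~ c : a b / a + b}.
Proof.
by move=> a b; apply/malgP => s; rewrite mcoeffD !chain_scaleE mulrDl.
Qed.

HB.instance Definition _ := GRing.Zmodule_isLmodule.Build G (chain k X)
  chain_scaleA chain_scale1 chain_scaleDr chain_scaleDl.

Definition chain1 s : chain k X := mkmalgU s 1.

Definition carrier c : set X := \bigcup_(s in [set` msupp c]) range s.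

Section Extend.
Variables (M : lmodType G) (f : sing R k X -> M).

Definition chain_extend c : M := \sum_(s <- msupp c) mcoeff s c *: f s.

Lemma chain_extendEw c (d : {fset sing R k X}) : (msupp c `<=` d)%fset ->
  chain_extend c = \sum_(s <- d) mcoeff s c *: f s.
Proof.
move=> cd; apply: big_fset_incl => // s _ /mcoeff_outdom ->.
by rewrite scale0r.
Qed.

Lemma chain_extend_is_linear : linear chain_extend.
Proof.
move=> a c d; pose e := (msupp c `|` msupp d `|` msupp (a *: c + d)%R)%fset.
have ce : (msupp c `<=` e)%fset.
  by apply/fsubsetP => s; rewrite !in_fsetU => ->.
have de : (msupp d `<=` e)%fset.
  by apply/fsubsetP => s; rewrite !in_fsetU => ->; rewrite orbT.
have cde : (msupp (a *: c + d) `<=` e)%fset.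
  by apply/fsubsetP => s; rewrite !in_fsetU => ->; rewrite !orbT.
rewrite (chain_extendEw ce) (chain_extendEw de) (chain_extendEw cde).
rewrite scaler_sumr -big_split; apply: eq_bigr => s _ /=.
by rewrite mcoeffD chain_scaleE scalerDl scalerA.
Qed.

HB.instance Definition _ :=
  GRing.isLinear.Build G (chain k X) M _ chain_extend chain_extend_is_linear.

Lemma chain_extend1 s : chain_extend (chain1 s) = f s.
Proof.
by rewrite (chain_extendEw msuppU_le) big_seq_fset1 mcoeffUU scale1r.
Qed.

End Extend.
End Module.

Definition aug X : {linear chain 0 X -> G^o} :=
  chain_extend (fun=> 1 : G^o).

Definition bdry_sing k X (s : sing R k.+1 X) : chain k X :=
  \sum_(i < k.+2) (-1) ^+ i *: chain1 (sing_restr (lift i) s).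

Definition bdry k X : {linear chain k.+1 X -> chain k X} :=
  chain_extend (@bdry_sing k X).

Definition chain_push X Y (f : continuousType X Y) k :
    {linear chain k X -> chain k Y} :=
  chain_extend (fun s => chain1 (sing_push f s)).

Lemma chain_linear_eq k X (M : lmodType G) (f g : {linear chain k X -> M}) :
  (forall s, f (chain1 s) = g (chain1 s)) -> f =1 g.
Proof.
move=> fg c.
have -> : c = \sum_(s <- msupp c) mcoeff s c *: chain1 s.
  rewrite {1}(monalgE c); apply: eq_bigr => s _.
  by apply/malgP => t; rewrite chain_scaleE !mcoeffU mulrnAr mulr1.
by rewrite !linear_sum; apply: eq_bigr => s _; rewrite !linearZ_LR fg.
Qed.

Lemma bdry_push X Y (f : continuousType X Y) k (c : chain k.+1 X) :
  bdry _ _ (chain_push f _ c) = chain_push f _ (bdry _ _ c).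
Proof.
apply: (chain_linear_eq (f := bdry k Y \o chain_push f k.+1)
  (g := chain_push f k \o bdry k X)) => s /=.
rewrite !chain_extend1 /bdry_sing linear_sum; apply: eq_bigr => i _.
rewrite linearZ_LR /= chain_extend1; congr (_ *: chain1 _).
exact/continuousEP.
Qed.

Lemma aug_push X Y (f : continuousType X Y) (c : chain 0 X) :
  aug _ (chain_push f _ c) = aug _ c.
Proof.
apply: (chain_linear_eq (f := aug Y \o chain_push f 0) (g := aug X)) => s /=.
by rewrite !chain_extend1.
Qed.

(* Degree 0 uses the augmentation: the homology is reduced. *)
Definition is_cycle k X : chain k X -> Prop :=
  match k with
  | 0 => fun c => aug X c = 0
  | k'.+1 => fun c => bdry k' X c = 0
  end.

Lemma is_cycle0 k X : is_cycle (0 : chain k X).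
Proof. by case: k => [|k] /=; rewrite linear0. Qed.

Lemma is_cycleB k X (c d : chain k X) :
  is_cycle c -> is_cycle d -> is_cycle (c - d).
Proof.
case: k c d => [|k] c d; rewrite /is_cycle => c0 d0;
  by rewrite linearB c0 d0 subrr.
Qed.

Lemma is_cycle_push X Y (f : continuousType X Y) k (c : chain k X) :
  is_cycle c -> is_cycle (chain_push f k c).
Proof.
case: k c => [|k] c; rewrite /is_cycle => c0; first by rewrite aug_push.
by rewrite bdry_push c0 linear0.
Qed.

Definition cycle_pred k X : {pred chain k X} := fun c => `[< is_cycle c >].

Lemma cycle_zmod_closed k X : zmod_closed (@cycle_pred k X).
Proof.
split=> [|c d /asboolP c0 /asboolP d0]; apply/asboolP; first exact: is_cycle0.
exact: is_cycleB.
Qed.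

HB.instance Definition _ k X :=
  GRing.isZmodClosed.Build (chain k X) (@cycle_pred k X)
    (@cycle_zmod_closed k X).

Definition cycle k X : Type := {c : chain k X | c \in @cycle_pred k X}.

HB.instance Definition _ k X := [isSub for @sval _ _ : cycle k X -> chain k X].
HB.instance Definition _ k X := [Choice of cycle k X by <:].
HB.instance Definition _ k X :=
  [SubChoice_isSubZmodule of cycle k X by <:].

Definition bounds_pred k X : {pred cycle k X} :=
  fun z => `[< exists d, bdry k X d = val z >].

Lemma bounds_zmod_closed k X : zmod_closed (@bounds_pred k X).
Proof.
split=> [|y z /asboolP[c cy] /asboolP[d dz]]; apply/asboolP.
  by exists 0; rewrite linear0.
by exists (c - d); rewrite linearB cy dz.
Qed.

HB.instance Definition _ k X :=
  GRing.isZmodClosed.Build (cycle k X) (@bounds_pred k X)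
    (@bounds_zmod_closed k X).

Definition homology k X : zmodType := Quotient.quot (@bounds_pred k X).

Definition cycle_push X Y (f : continuousType X Y) k (z : cycle k X) :
    cycle k Y :=
  exist _ (chain_push f k (val z))
    (asboolT (is_cycle_push f (asboolW (valP z)))).

Lemma cycle_pushB X Y (f : continuousType X Y) k (y z : cycle k X) :
  cycle_push f (y - z) = cycle_push f y - cycle_push f z.
Proof. by apply/val_inj; rewrite /= linearB. Qed.

Lemma homology_eqP k X (y z : cycle k X) :
  \pi_(homology k X) y = \pi_(homology k X) z <->
  exists d, bdry k X d = val y - val z.
Proof.
split=> [/eqP|[d dyz]]; last apply/eqP; rewrite -Quotient.idealrBE.
  by move=> /asboolP.
by apply/asboolP; exists d.
Qed.

Definition homology_map X Y (f : continuousType X Y) k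
    (a : homology k X) : homology k Y :=
  \pi_(homology k Y) (cycle_push f (repr a)).

Lemma homology_map_pi X Y (f : continuousType X Y) k (z : cycle k X) :
  homology_map f (\pi_(homology k X) z) = \pi_(homology k Y) (cycle_push f z).
Proof.
have /homology_eqP[d dz] := reprK (\pi_(homology k X) z).
apply/homology_eqP; exists (chain_push f k.+1 d).
by rewrite bdry_push dz linearB.
Qed.

End Chains.

Arguments chain1 {R G k X} s.
Arguments carrier {R G k X} c.
Arguments aug {R G X}.
Arguments bdry {R G k X}.
Arguments homology R G k X : clear implicits.
Arguments homology_map {R} G {X Y} f k a.

Section SubsetInclusion.
Variables (X : topologicalType) (A B : set X) (AB : A `<=` B).

Definition subset_incl_fun (x : A) : B :=
  exist _ (set_val x) (mem_set (AB (set_valP x))).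

Lemma subset_incl_continuous : continuous subset_incl_fun.
Proof. apply: continuous_comp_initial; exact: initial_continuous. Qed.

Definition subset_incl : continuousType A B := mkcts subset_incl_continuous.

End SubsetInclusion.

Definition homologically_lc (R : realType) (G : comPzRingType) (n : nat)
    (X : topologicalType) :=
  forall (x : X) (U : set X), nbhs x U ->
  exists V : set X, nbhs x V /\
  exists VU : V `<=` U,
    forall k, (k <= n)%N -> forall a : homology R G k V,
      homology_map G (subset_incl VU) k a = 0.

Section ChainMorphisms.
Variables (R : realType) (G : comPzRingType) (n : nat).
Variables (Z X : topologicalType).

(* The degrees of the truncated complex of Z are the k with a proof of
   (k <= n). *)
Record chain_morphism := ChainMorphism {
  chain_mor :>
    forall k, (k <= n)%N -> {linear chain R G k Z -> chain R G k X};
  chain_mor_bdry : forall k (lt_kn : (k.+1 <= n)%N) (c : chain R G k.+1 Z),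
    bdry (chain_mor lt_kn c) = chain_mor (ltnW lt_kn) (bdry c);
  chain_mor_aug : forall c : chain R G 0 Z,
    aug (chain_mor (leq0n n) c) = aug c
}.

Definition correct_morphism (phi : chain_morphism) :=
  forall s : sing R 0 Z, exists t : sing R 0 X,
    phi 0 (leq0n n) (chain1 s) = chain1 t.

Definition cover_close (U : set (set X)) (phi psi : chain_morphism) :=
  forall k (s : sing R k Z), (k <= n)%N ->
  exists2 A, U A &
    forall m (le_mn : (m <= n)%N) (t : sing R m Z), is_face t s ->
      carrier (phi m le_mn (chain1 t)) `|` carrier (psi m le_mn (chain1 t))
        `<=` A.

Definition degree1_map :=
  forall k, (k <= n)%N -> {linear chain R G k Z -> chain R G k.+1 X}.

Definition chain_homotopy (phi psi : chain_morphism) (D : degree1_map) :=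
  (forall s : sing R 0 Z,
     bdry (D 0 (leq0n n) (chain1 s)) =
     phi 0 (leq0n n) (chain1 s) - psi 0 (leq0n n) (chain1 s)) /\
  (forall k (lt_kn : (k.+1 <= n)%N) (s : sing R k.+1 Z),
     bdry (D k.+1 lt_kn (chain1 s)) =
     phi k.+1 lt_kn (chain1 s) - psi k.+1 lt_kn (chain1 s)
     - D k (ltnW lt_kn) (bdry (chain1 s))).

Definition cover_small (U : set (set X)) (phi psi : chain_morphism)
    (D : degree1_map) :=
  forall k (s : sing R k Z), (k <= n)%N ->
  exists2 A, U A &
    (forall m (le_mn : (m <= n)%N) (t : sing R m Z), is_face t s ->
       carrier (D m le_mn (chain1 t)) `<=` A) /\
    (forall v : sing R 0 Z, is_vertex v s ->
       carrier (phi 0 (leq0n n) (chain1 v)) `|`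
       carrier (psi 0 (leq0n n) (chain1 v)) `<=` A).

End ChainMorphisms.

(* Main.v *)
(* Call the union of the members of a cover that meet a given member the star of
   that member.  Paracompactness yields star refinements, so if X is lc^n one
   builds covers C_0, ..., C_(n+1) = U such that the star of each member of C_k
   lies in a member of C_(k+1) in which its k-cycles bound.  For C_0-close phi
   and psi, the homotopy is built degree by degree with D_k s carried by a member
   of C_(k+1) which also contains everything attached to the faces of s: the
   carriers of D on the facets of s all meet a member of C_k containing the
   carriers of phi s and psi s, so that the cycle phi s - psi s - D (bdry s) lies
   in a star.

   Conversely, given a neighbourhood U of x, take V as in the statement for the
   cover {int U, X \ {x}}, and a closed neighbourhood Z of x contained in U and
   in a member of V.  A small homotopy D between the chain maps induced by the
   inclusion of Z and by the constant map x is carried by U, since no member of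
   the cover other than int U contains x.  For a cycle c in Z, D c bounds c up to
   a constant cycle, which bounds in {x}. *)
Require Import Defs.
From mathcomp Require Import all_boot all_order all_algebra finmap zify.
From mathcomp.multinomials Require Import -(notations) monalg.
From mathcomp Require Import all_classical all_reals topology normedtype.

Set Implicit Arguments.
Unset Strict Implicit.
Unset Printing Implicit Defensive.

Import GRing.Theory Num.Theory.

Local Open Scope classical_set_scope.
Local Open Scope quotient_scope.
Local Open Scope ring_scope.

(** * Star refinements in paracompact spaces *)

Section Paracompact.
Variable X : topologicalType.
Implicit Types (x y z : X) (A B : set X) (U V : set (set X)).

(** Only finitely many members of [V] meet a suitable neighbourhood of [x], and the conditions that
    these impose can be intersected; the other members impose none. *)
Lemma locally_finite_near V x (F : set X -> set X) :
  locally_finite V -> (forall B, V B -> nbhs x (F B)) ->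
  exists2 N, nbhs x N & forall B y, V B -> B `&` N !=set0 -> N y -> F B y.
Proof.
move=> /(_ x)[N Nx finN] VF; pose S := [set B | V B /\ B `&` N !=set0].
have nF : nbhs x (\bigcap_(B in S) F B).
  have [D DE] := finite_fsetP.1 finN; rewrite [S]DE bigcap_fset.
  rewrite big_seq; apply: big_ind => [|A B|B BD]; first exact: filterT.
    exact: filterI.
  have : [set` D] B by [].
  by rewrite -DE => -[/VF].
exists (N `&` \bigcap_(B in S) F B); first exact: filterI.
by move=> B y VB [z [Bz [Nz _]]] [_]; apply; split=> //; exists z.
Qed.

Lemma cover_point U x : open_cover U -> exists2 A, U A & A x.
Proof. by move=> [_ UT]; have : [set: X] x by []; rewrite -UT. Qed.

Lemma open_cover_nbhs U A x : open_cover U -> U A -> A x -> nbhs x A.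
Proof. by move=> [oU _] /oU oA Ax; exact: open_nbhs_nbhs. Qed.

Lemma not_closure_near B x : ~ closure B x -> nbhs x (~` closure B).
Proof.
move=> nBx; apply: open_nbhs_nbhs; split=> //.
exact/closed_openC/closed_closure.
Qed.

Hypothesis pX : paracompact X.

(** Regularity. By the Hausdorff property the interior of [A] and the open sets whose closure misses
    [x] cover [X]. In a locally finite refinement, the members not inside the interior have closures
    missing [x], so by local finiteness the complement of their union is a neighbourhood of [x]. *)
Lemma paracompact_closed_nbhs x A :
  nbhs x A -> exists C, [/\ closed C, nbhs x C & C `<=` A].
Proof.
move=> Ax; have : A° x := Ax.
move: (A°) (open_interior A) (@interior_subset _ A) => A' oA A'A A'x.
pose U := [set A'] `|` [set W | open W /\ ~ closure W x].
have [V [[oV VT] VU lfV]] : exists V,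
    [/\ open_cover V, refines V U & locally_finite V].
  apply: pX.2; split=> [W [->//|[]//]|]; apply/seteqP; split=> // y _.
  have [A'y|nA'y] := pselect (A' y); first by exists A' => //; left.
  have /eqP yx : y <> x by move=> yx; rewrite yx in nA'y.
  have := pX.1; rewrite open_hausdorff => /(_ _ _ yx).
  move=> [[P Q] [/= Py Qx] [oP oQ /eqP PQ0]].
  exists P; last exact: set_mem.
  right; split=> // /(_ Q); have nQ : nbhs x Q.
    by apply: open_nbhs_nbhs; split=> //; exact: set_mem.
  by move=> /(_ nQ)[z]; rewrite PQ0.
exists (~` \bigcup_(B in [set B | V B /\ ~ B `<=` A']) B); split.
- by apply: open_closedC; apply: bigcup_open => B [VB _]; exact: oV.
- have [|N Nx NF] := @locally_finite_near V x
      (fun B => [set z | B `<=` A' \/ ~ closure B z]) lfV.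
    move=> B VB; have [W [->|[_ nW]] BW] := VU _ VB.
      by apply: filterS filterT => z _; left.
    have nB : ~ closure B x by move=> /(closure_subset BW).
    by apply: filterS (not_closure_near nB) => z ?; right.
  apply: (filterS _ Nx) => y Ny [B [VB nBA] By].
  have [|//|] := NF B y VB _ Ny; first by exists y.
  by apply; exact: subset_closure.
- move=> y nVy; have [B VB By] : (\bigcup_(B in V) B) y by rewrite VT.
  apply: A'A; apply: contrapT => nA'y; apply: nVy; exists B => //.
  by split=> // BA; exact/nA'y/BA.
Qed.

(** [N x] is so small that each [B] in [V] meeting it either has [x] in its closure, and then [N x]
    lies in [a B], or has a closure disjoint from [N x]. If [y] is in [B] and in [N x], the second
    case is excluded, so [a B] serves every such [x]. *)
Lemma barycentric_refinement U : open_cover U ->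
  exists O : X -> set X, (forall x, open (O x) /\ O x x) /\
    forall y, exists2 A, U A & forall x, O x y -> O x `<=` A.
Proof.
move=> cU; pose W := [set B | open B /\ exists2 A, U A & closure B `<=` A].
have [V [cV VW lfV]] : exists V,
    [/\ open_cover V, refines V W & locally_finite V].
  apply: pX.2; split=> [B []//|]; apply/seteqP; split=> // x _.
  have [A UA Ax] := cover_point x cU.
  have [C [cC Cx CA]] := paracompact_closed_nbhs (open_cover_nbhs cU UA Ax).
  exists C^°; last exact: Cx.
  split; first exact: open_interior.
  exists A => //; apply: subset_trans CA.
  rewrite [X in _ `<=` X]((closure_id C).1 cC).
  by apply: closure_subset; exact: interior_subset.
have /choice[a aP] : forall B, exists A, V B -> U A /\ closure B `<=` A.
  move=> B; have [VB|nVB] := pselect (V B); last by exists set0.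
  have [B' [_ [A UA B'A]] BB'] := VW _ VB; exists A => _; split=> //.
  by apply: subset_trans B'A; exact: closure_subset.
have /choice[N NP] : forall x, exists N, nbhs x N /\
    forall B y, V B -> B `&` N !=set0 -> N y ->
      if pselect (closure B x) then a B y else ~ closure B y.
  move=> x; have [|N Nx NF] := @locally_finite_near V x
      (fun B => [set y | if pselect (closure B x) then a B y
                         else ~ closure B y]) lfV; last by exists N.
  move=> B VB; have [UA BA] := aP _ VB; case: pselect => [Bx|nBx].
    by apply: open_cover_nbhs cU UA _; exact: BA.
  exact: not_closure_near.
exists (fun x => (N x)^°); split=> [x|y].
  by split; [exact: open_interior | exact: (NP x).1].
have [B VB By] := cover_point y cV; exists (a B); first exact: (aP _ VB).1.
move=> x /interior_subset Ny z /interior_subset Nz.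
have BN : B `&` N x !=set0 by exists y.
have := (NP x).2 B y VB BN Ny; have := (NP x).2 B z VB BN Nz.
by case: pselect => [//|nBx _ /(_ (subset_closure By))].
Qed.

(** Two barycentric refinements in a row: if [O y] and [O x] share [z], both lie in one [P w], and
    every [P w] containing [x] lies in the member of [U] chosen for [x]. *)
Lemma star_refinement U : open_cover U ->
  exists O : X -> set X, (forall x, open (O x) /\ O x x) /\
    forall x, exists2 A, U A & forall y, O y `&` O x !=set0 -> O y `<=` A.
Proof.
move=> /barycentric_refinement[P [oP PU]].
have cP : open_cover (range P).
  split=> [_ [x _ <-]|]; first exact: (oP x).1.
  by apply/seteqP; split=> // x _; exists (P x); [exists x | exact: (oP x).2].
have [O [oO OP]] := barycentric_refinement cP.
exists O; split=> // x; have [A UA PA] := PU x; exists A => // y [z [Oyz Oxz]].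
have [_ [w _ <-] OPw] := OP z.
by apply: subset_trans (OPw y Oyz) (PA _ _); apply: OPw Oxz _ (oO x).2.
Qed.

End Paracompact.

(** Open sets of [C] are traces of open sets of [X]; together with the complement of [C] these cover
    [X], and the traces of a locally finite refinement are the required cover. *)
Lemma paracompact_closed_subspace (X : topologicalType) (C : set X) :
  paracompact X -> closed C -> paracompact C.
Proof.
move=> pX cC; have cval := @initial_continuous _ _ (set_val : C -> X).
split=> [p q pq|U [oU UT]].
  apply: val_inj; apply: pX.1 => A B Ap Bq.
  by have [z []] := pq _ _ (cval _ _ Ap) (cval _ _ Bq); exists (set_val z).
pose U' := [set ~` C] `|`
  [set A | open A /\ U ((set_val : C -> X) @^-1` A)].
have [V [[oV VT] VU lfV]] : exists V,
    [/\ open_cover V, refines V U' & locally_finite V].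
  apply: pX.2; split=> [A [->|[]//]|]; first exact: closed_openC.
  apply/seteqP; split=> // x _.
  have [Cx|nCx] := pselect (C x); last by exists (~` C) => //; left.
  have [A UA Ax] : (\bigcup_(A in U) A) (exist _ x (mem_set Cx)) by rewrite UT.
  have [A' oA' A'A] := oU _ UA.
  exists A'; first by right; split=> //; rewrite A'A.
  by move: Ax; rewrite -A'A.
(* Empty traces are discarded: when [C] is empty, [U] may have no member to contain them. *)
exists [set (set_val : C -> X) @^-1` B | B in
  [set B | V B /\ (set_val : C -> X) @^-1` B !=set0]].
split=> [|_ [B [VB [p Bp]] <-]|p].
- split=> [_ [B [VB _] <-]|]; first by exists B => //; exact: oV.
  apply/seteqP; split=> // p _.
  have [B VB Bp] : (\bigcup_(B in V) B) (set_val p) by rewrite VT.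
  by exists (set_val @^-1` B) => //; exists B => //; split=> //; exists p.
- have [A [->|[oA UA]] BA] := VU _ VB.
    by have := BA _ Bp; have := set_valP p.
  by exists (set_val @^-1` A) => // q Bq; exact: BA.
- have [N Np finN] := lfV (set_val p).
  exists (set_val @^-1` N); first exact: cval.
  apply: sub_finite_set (finite_image _ finN) => _ [[B [VB _] <-] [q [Bq Nq]]].
  by exists B => //; split=> //; exists (set_val q).
Qed.

(** * Singular chains *)

Section Restriction.
Variables (R : realType) (X : topologicalType).

Lemma sing_restr_comp l m k (g : 'I_l.+1 -> 'I_m.+1) (f : 'I_m.+1 -> 'I_k.+1)
    (s : sing R k X) :
  sing_restr g (sing_restr f s) = sing_restr (f \o g) s.
Proof.
apply/continuousEP => t; congr (s _); apply: val_inj; apply/rowP => j /=.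
rewrite !mxE [RHS](partition_big g (fun i => f i == j)) //=.
apply: eq_bigr => i /eqP fi; rewrite mxE; apply: eq_bigl => a.
by case: eqP => [->|]; rewrite ?andbF // fi eqxx.
Qed.

Lemma sing_restr_id k (s : sing R k X) : sing_restr id s = s.
Proof.
apply/continuousEP => t; congr (s _); apply: val_inj; apply/rowP => j /=.
by rewrite mxE (big_pred1 j).
Qed.

(** Induction from the bottom gives [i <= f i], induction from the top [f i <= i]. *)
Lemma increasing_ord_id k (f : 'I_k -> 'I_k) :
  {homo f : i j / (i < j)%N} -> f =1 id.
Proof.
move=> f_mono.
have ge_id m (i : 'I_k) : i = m :> nat -> (m <= f i)%N.
  elim: m i => // m IH i im; have lt_mk : (m < k)%N.
    by have := ltn_ord i; rewrite im; apply: ltnW.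
  have := f_mono (Ordinal lt_mk) i; rewrite /= im => /(_ (leqnn _)).
  exact: leq_ltn_trans (IH _ _).
have le_id m (i : 'I_k) : (i + m = k.-1 -> f i <= i)%N.
  elim: m i => [|m IH] i im.
    by have := ltn_ord (f i); have := ltn_ord i; lia.
  have lt_ik : (i.+1 < k)%N by lia.
  have := f_mono i (Ordinal lt_ik) (leqnn _).
  by have := IH (Ordinal lt_ik); rewrite /=; lia.
move=> i; apply: val_inj; apply/eqP; rewrite eqn_leq ge_id // andbT.
by apply: (le_id (k.-1 - i)%N); have := ltn_ord i; lia.
Qed.

Lemma lift_factor m k (f : 'I_m.+1 -> 'I_k.+2) i :
  {homo f : a b / (a < b)%N} -> (forall a, f a != i) ->
  exists2 g : 'I_m.+1 -> 'I_k.+1,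
    {homo g : a b / (a < b)%N} & f = lift i \o g.
Proof.
move=> f_mono fNi; have /choice[g gP] : forall a, exists b, f a = lift i b.
  move=> a; have := fNi a; rewrite eq_sym => /unlift_some[b fab _].
  by exists b.
exists g; last exact/funext.
move=> a b /f_mono; rewrite !gP /= /bump; lia.
Qed.

(** Reduces faces to facets. An increasing map that misses a vertex [i] factors through [lift i], so
    the face is one of a facet; a map that misses none is bijective, hence the identity. *)
Lemma is_face_ind m (t : sing R m X) (P : forall k, sing R k X -> Prop) :
  P m t -> (forall k (s : sing R k.+1 X) (i : 'I_k.+2),
     P k (sing_restr (lift i) s) -> P k.+1 s) ->
  forall k (s : sing R k X), is_face t s -> P k s.
Proof.
move=> Pt Pface; elim=> [|k IH] s [f f_mono ts].
  have m0 : m = 0%N.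
    case: m f f_mono {t Pt ts} => // m f /(_ ord0 ord_max isT).
    by rewrite !ord1.
  move: t f f_mono Pt ts; rewrite m0 => t f f_mono Pt ts.
  rewrite (_ : s = t) // ts (_ : f = id) ?sing_restr_id //.
  by apply/funext => i; rewrite ord1 [RHS]ord1.
have [i /forallP fNi|f_surj] := pickP (fun i => [forall a, f a != i]).
  apply: (Pface _ _ i); apply: IH; have [g g_mono fE] := lift_factor f_mono fNi.
  by exists g; rewrite // ts sing_restr_comp fE.
have f_inj : injective f.
  move=> a b fab; apply: val_inj.
  by case: (ltngtP a b) => // /f_mono; rewrite fab ltnn.
have mk : m = k.+1.
  apply: succn_inj; rewrite -[m.+1]card_ord -(card_codom f_inj).
  rewrite -[RHS]card_ord; apply/eq_card => i; rewrite [RHS]inE.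
  have /negbT := f_surj i; rewrite negb_forall => /existsP[a].
  by rewrite negbK => /eqP <-; rewrite codom_f.
move: t f f_mono Pt ts {f_surj f_inj IH}; rewrite mk => t f f_mono Pt ts.
rewrite (_ : s = t) // ts (_ : f = id) ?sing_restr_id //.
exact/funext/increasing_ord_id.
Qed.

Lemma is_face_refl k (s : sing R k X) : is_face s s.
Proof. by exists id; rewrite ?sing_restr_id. Qed.

Lemma vertex_exists k (s : sing R k X) : exists v, is_vertex v s.
Proof.
exists (sing_restr (fun=> ord0) s); exists (fun=> ord0) => // i j.
by rewrite !ord1.
Qed.

Lemma vertex_facet k (i : 'I_k.+2) (v : sing R 0 X) (s : sing R k.+1 X) :
  is_vertex v (sing_restr (lift i) s) -> is_vertex v s.
Proof.
move=> [f _ ->]; rewrite sing_restr_comp; exists (lift i \o f) => // a b.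
by rewrite !ord1.
Qed.

End Restriction.

Lemma alternating_sum_lift (G : pzRingType) (M : lmodType G) k
    (F : ('I_k.+1 -> 'I_k.+3) -> M) :
  \sum_(i < k.+3) \sum_(j < k.+2) (-1) ^+ (i + j) *: F (lift i \o lift j) = 0.
Proof.
(* The terms cancel in pairs: for j < i, lift i \o lift j = lift j \o lift i.-1. *)
rewrite pair_big /= (bigID (fun p : 'I_k.+3 * 'I_k.+2 => (p.2 < p.1)%N)) /=.
pose h (p : 'I_k.+3 * 'I_k.+2) : 'I_k.+3 * 'I_k.+2 :=
  (inord p.2, inord p.1.-1).
rewrite [X in _ + X](reindex_onto h
  (fun p => (inord p.2.+1, inord p.1))) /=; last first.
  move=> [i j] /=; rewrite -leqNgt /h /= => ij; have := ltn_ord j.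
  by move=> jk; congr (_, _); apply: val_inj; rewrite /= !inordK //; lia.
rewrite [X in _ + X](eq_bigl (fun p : 'I_k.+3 * 'I_k.+2 => (p.2 < p.1)%N)).
  rewrite -big_split big1 //= => -[i j] /= ji.
  have lt_ik := ltn_ord i; have lt_jk := ltn_ord j.
  rewrite !inordK; [|lia..].
  rewrite (_ : lift (inord j) \o lift (inord i.-1) = lift i \o lift j).
    rewrite (_ : i + j = (j + i.-1).+1)%N; last lia.
    by rewrite exprS mulN1r scaleNr addNr.
  apply/funext => a; apply: val_inj; rewrite /= /bump !inordK; lia.
move=> [i j] /=; have lt_ik := ltn_ord i; have lt_jk := ltn_ord j.
apply/andP/idP => [[]|ji].
  rewrite -leqNgt !inordK; [|lia..] => ij /eqP[] /(congr1 val) /=.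
  rewrite inordK; [|lia]; lia.
rewrite -leqNgt !inordK; [|lia..]; split; first lia.
by apply/eqP; congr (_, _); apply: val_inj; rewrite /= ?inordK //; lia.
Qed.

Lemma chainE (R : realType) (G : comPzRingType) (X : topologicalType) k
    (c : chain R G k X) :
  c = \sum_(s <- msupp c) mcoeff s c *: chain1 s.
Proof.
rewrite {1}(monalgE c); apply: eq_bigr => s _.
by apply/malgP => t; rewrite chain_scaleE !mcoeffU mulrnAr mulr1.
Qed.

Lemma chain_push1 (R : realType) (G : comPzRingType) (X Y : topologicalType)
    (f : continuousType X Y) k (s : sing R k X) :
  chain_push R G f k (chain1 s) = chain1 (sing_push f s).
Proof. exact: chain_extend1. Qed.

Lemma bdry1 (R : realType) (G : comPzRingType) (X : topologicalType) k
    (s : sing R k.+1 X) :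
  bdry (chain1 s) = \sum_(i < k.+2) (-1) ^+ i *: chain1 (sing_restr (lift i) s)
    :> chain R G k X.
Proof. exact: chain_extend1. Qed.

(** * Carriers of chains *)

Section Carrier.
Variables (R : realType) (G : comPzRingType) (X : topologicalType).
Implicit Types (A : set X) (k : nat).

Lemma carrierP k (c : chain R G k X) A :
  carrier c `<=` A <-> forall s, mcoeff s c != 0 -> range s `<=` A.
Proof.
split=> [cA s|cA x [s /= s_c]]; last by apply: cA; rewrite mcoeff_neq0.
by rewrite mcoeff_neq0 => s_c x sx; apply: cA; exists s.
Qed.

Lemma carrier0 k A : carrier (0 : chain R G k X) `<=` A.
Proof. by apply/carrierP => s; rewrite mcoeff0 eqxx. Qed.

Lemma carrierD k (c d : chain R G k X) A :
  carrier c `<=` A -> carrier d `<=` A -> carrier (c + d) `<=` A.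
Proof.
move=> /carrierP cA /carrierP dA; apply/carrierP => s; rewrite mcoeffD.
have [c0|/cA//] := eqVneq (mcoeff s c) 0; rewrite c0 add0r; exact: dA.
Qed.

Lemma carrierZ k a (c : chain R G k X) A :
  carrier c `<=` A -> carrier (a *: c) `<=` A.
Proof.
move=> /carrierP cA; apply/carrierP => s; rewrite chain_scaleE.
by have [->|/cA//] := eqVneq (mcoeff s c) 0; rewrite mulr0 eqxx.
Qed.

Lemma carrierB k (c d : chain R G k X) A :
  carrier c `<=` A -> carrier d `<=` A -> carrier (c - d) `<=` A.
Proof.
by move=> cA dA; rewrite -scaleN1r; apply: carrierD => //; exact: carrierZ.
Qed.

Lemma carrier1 k (s : sing R k X) :
  carrier (chain1 s : chain R G k X) `<=` range s.
Proof.
apply/carrierP => t; rewrite mcoeffU.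
have [->|_] := eqVneq s t; first by move=> _ x.
by rewrite eqxx.
Qed.

Lemma carrier_linear (Y : topologicalType) k l
    (f : {linear chain R G l Y -> chain R G k X}) (c : chain R G l Y) A :
  (forall s, carrier (f (chain1 s)) `<=` A) -> carrier (f c) `<=` A.
Proof.
move=> fA; rewrite (chainE c) linear_sum.
apply: (big_ind (fun d : chain R G k X => carrier d `<=` A)).
- exact: carrier0.
- by move=> d e; exact: carrierD.
- by move=> s _; rewrite linearZ_LR; exact: carrierZ.
Qed.

Lemma carrier_bdry (Y : topologicalType) k l
    (f : {linear chain R G l Y -> chain R G k X}) (s : sing R l.+1 Y) A :
  (forall i : 'I_l.+2, carrier (f (chain1 (sing_restr (lift i) s))) `<=` A) ->
  carrier (f (bdry (chain1 s))) `<=` A.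
Proof.
move=> fA; rewrite bdry1 linear_sum.
apply: (big_ind (fun d : chain R G k X => carrier d `<=` A)).
- exact: carrier0.
- by move=> d e; exact: carrierD.
- by move=> i _; rewrite linearZ_LR; exact: carrierZ.
Qed.

Lemma bdry_bdry k (c : chain R G k.+2 X) : bdry (bdry c) = 0.
Proof.
apply: (chain_linear_eq (f := bdry \o bdry) (g := \0)) => s /=.
rewrite bdry1 linear_sum.
rewrite -[RHS](alternating_sum_lift
  (fun f => chain1 (sing_restr f s) : chain R G k X)).
apply: eq_bigr => i _; rewrite linearZ_LR /= bdry1 scaler_sumr.
by apply: eq_bigr => j _; rewrite scalerA -exprD sing_restr_comp.
Qed.

Lemma trivial_ring_chain k (c d : chain R G k X) : (1 : G) = 0 -> c = d.
Proof. by move=> G0; rewrite -[c]scale1r -[d]scale1r G0 !scale0r. Qed.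

Lemma carrier_nonempty k (s : sing R k X) :
  (1 : G) != 0 -> carrier (chain1 s : chain R G k X) !=set0.
Proof.
(* The vertex [e] shows that the standard simplex is nonempty; [1 != 0] keeps [s] in the support of
   [chain1 s]. *)
move=> G1; pose e : 'rV[R]_k.+1 := \row_i (i == ord0)%:R.
have eP : e \in @simplex_set R k.
  apply: mem_set; split=> [i|]; first by rewrite mxE ler0n.
  rewrite (bigD1 ord0) //= big1 ?addr0 ?mxE ?eqxx // => i /negPf i0.
  by rewrite mxE i0.
exists (s (exist _ e eP)); exists s => /=; last by exists (exist _ e eP).
by rewrite -mcoeff_neq0 mcoeffUU.
Qed.

End Carrier.

(** * Chains of a subspace as chains of the ambient space *)

Section Subspace.
Variables (R : realType) (G : comPzRingType) (X : topologicalType).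
Implicit Types (A B : set X) (k : nat).

Definition set_incl A : continuousType A X :=
  mkcts (@initial_continuous _ _ (set_val : A -> X)).

Section Corestriction.
Variables (A : set X) (k : nat) (s : sing R k X) (sA : range s `<=` A).

Definition sing_corestr_fun (t : simplex R k) : A :=
  exist _ (s t) (mem_set (sA (imageT s t))).

Lemma sing_corestr_continuous : continuous sing_corestr_fun.
Proof. by apply: continuous_comp_initial; exact: cts_fun. Qed.

Definition sing_corestr : sing R k A := mkcts sing_corestr_continuous.

Lemma sing_corestrK : sing_push (set_incl A) sing_corestr = s.
Proof. exact/continuousEP. Qed.

End Corestriction.

(** Simplexes that leave [A] are sent to zero. This does not commute with boundaries in general, but
    it inverts the inclusion on chains carried by [A]. *)
Definition chain_corestr A k : {linear chain R G k X -> chain R G k A} :=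
  chain_extend (fun s => if pselect (range s `<=` A) is left sA
                         then chain1 (sing_corestr sA) else 0).

Lemma chain_corestr1 A k (s : sing R k X) (sA : range s `<=` A) :
  chain_corestr A k (chain1 s) = chain1 (sing_corestr sA).
Proof.
rewrite [LHS]chain_extend1; case: pselect => // sA'.
by congr chain1; apply/continuousEP => t; apply: val_inj.
Qed.

Lemma chain_pushK A k :
  cancel (chain_push R G (set_incl A) k) (chain_corestr A k).
Proof.
apply: (chain_linear_eq
  (f := chain_corestr A k \o chain_push R G (set_incl A) k)
  (g := idfun)) => s /=.
have sA : range (sing_push (set_incl A) s) `<=` A.
  by move=> _ [t _ <-]; exact: set_valP.
rewrite chain_push1 (chain_corestr1 sA).
by congr chain1; apply/continuousEP => t; apply: val_inj.
Qed.

Lemma chain_corestrK A k (c : chain R G k X) :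
  carrier c `<=` A -> chain_push R G (set_incl A) k (chain_corestr A k c) = c.
Proof.
move=> cA; rewrite [in LHS](chainE c) [RHS](chainE c).
rewrite [X in chain_push _ _ _ _ X]linear_sum linear_sum.
apply: eq_big_seq => s s_c.
have sA : range s `<=` A by move=> x sx; apply: cA; exists s.
rewrite (linearZ_LR (chain_corestr A k)) linearZ_LR (chain_corestr1 sA).
by rewrite chain_push1 sing_corestrK.
Qed.

Lemma chain_push_carrier A k (c : chain R G k A) :
  carrier (chain_push R G (set_incl A) k c) `<=` A.
Proof.
apply: carrier_linear => s; rewrite chain_push1.
apply: subset_trans (@carrier1 _ _ _ _ _) _.
by move=> _ [t _ <-]; exact: set_valP.
Qed.

Lemma chain_push_incl A B (AB : A `<=` B) k (c : chain R G k A) :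
  chain_push R G (set_incl B) k (chain_push R G (subset_incl AB) k c) =
  chain_push R G (set_incl A) k c.
Proof.
apply: (chain_linear_eq
  (f := chain_push R G (set_incl B) k \o chain_push R G (subset_incl AB) k)
  (g := chain_push R G (set_incl A) k)) => s /=.
by rewrite !chain_push1; congr chain1; exact/continuousEP.
Qed.

(** The inclusion is a chain map and injective on chains, so the boundary can be tested after
    pushing back to [X]. *)
Lemma is_cycle_corestr A k (c : chain R G k X) :
  carrier c `<=` A -> is_cycle c -> is_cycle (chain_corestr A k c).
Proof.
move=> cA; have := chain_corestrK cA; move: (chain_corestr A k c) => d <-.
case: k c cA d => [|k] c cA d; rewrite /is_cycle.
  by rewrite aug_push.
rewrite bdry_push => /(congr1 (chain_corestr A k)).
by rewrite chain_pushK linear0.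
Qed.

(** Replaces homology classes of subspaces by chains of [X] with prescribed carriers, the form in
    which local connectedness is used below. *)
Lemma trivial_homologyP A B (AB : A `<=` B) k :
  (forall a : homology R G k A, homology_map G (subset_incl AB) k a = 0) <->
  forall c : chain R G k X, is_cycle c -> carrier c `<=` A ->
    exists2 d, carrier d `<=` B & bdry d = c.
Proof.
have pi0 z : \pi_(homology R G k B) z = 0 <->
    exists d, bdry d = val z.
  rewrite (_ : 0 = \pi_(homology R G k B) 0); last first.
    by rewrite !piE.
  by rewrite homology_eqP subr0.
split=> [H0 c c_cycle cA|bounds a].
  pose z : Defs.cycle R G k A := exist _ (chain_corestr A k c)
    (asboolT (is_cycle_corestr cA c_cycle)).
  have := H0 (\pi_(homology R G k A) z).
  rewrite homology_map_pi => /pi0[d dz].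
  exists (chain_push R G (set_incl B) k.+1 d); first exact: chain_push_carrier.
  by rewrite bdry_push dz /= chain_push_incl chain_corestrK.
rewrite -[a]reprK homology_map_pi; apply/pi0.
have [||d dB dE] := bounds (chain_push R G (set_incl A) k (val (repr a))).
- apply: is_cycle_push. exact: (asboolW (valP (repr a : Defs.cycle R G k A))).
- exact: chain_push_carrier.
exists (chain_corestr B k.+1 d).
apply: (can_inj (@chain_pushK B k)).
by rewrite -bdry_push chain_corestrK // dE chain_push_incl.
Qed.

End Subspace.

Arguments chain_corestr {R G X} A k.

(** * Small chain homotopies *)

Definition star (X : Type) (V : set (set X)) (B : set X) :=
  \bigcup_(B' in [set B' | V B' /\ B' `&` B !=set0]) B'.

Definition bounds_in (R : realType) (G : comPzRingType) (X : topologicalType)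
    k (A B : set X) :=
  forall c : chain R G k X, is_cycle c -> carrier c `<=` A ->
    exists2 d, carrier d `<=` B & bdry d = c.

Section Homotopy.
Variables (R : realType) (G : comPzRingType) (n : nat).
Variables (Z X : topologicalType) (phi psi : chain_morphism R G n Z X).
Variable C : nat -> set (set X).

(** The default value 0 makes the choice total, so the homotopy can be defined by recursion before
    fillings are known to exist. [K] must fit into the same member of the cover as the filling. *)
Definition fill k (z : chain R G k X) (K : set X) : chain R G k.+1 X * set X :=
  let d := xget 0 [set d | bdry d = z /\
    exists2 A, C k.+1 A & carrier d `|` K `<=` A] in
  (d, carrier d `|` K).

(* The second component collects the carriers of the homotopy on all faces and
   of both morphisms on all vertices: it is the set to be kept small. *)
Fixpoint htpy k : (k <= n)%N -> sing R k Z -> chain R G k.+1 X * set X :=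
  match k with
  | 0 => fun le_kn s =>
      fill (phi 0 le_kn (chain1 s) - psi 0 le_kn (chain1 s))
        (carrier (phi 0 le_kn (chain1 s)) `|` carrier (psi 0 le_kn (chain1 s)))
  | k'.+1 => fun le_kn s =>
      fill (phi k'.+1 le_kn (chain1 s) - psi k'.+1 le_kn (chain1 s)
            - chain_extend (fun t => (htpy (ltnW le_kn) t).1) (bdry (chain1 s)))
        (\bigcup_(i : 'I_k'.+2)
           (htpy (ltnW le_kn) (sing_restr (lift i) s)).2)
  end.

Definition htpy_map : degree1_map R G n Z X :=
  fun k le_kn => chain_extend (fun s => (htpy le_kn s).1).

Lemma htpy_map1 k (le_kn : (k <= n)%N) s :
  htpy_map le_kn (chain1 s) = (htpy le_kn s).1.
Proof. exact: chain_extend1. Qed.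

Lemma htpy_carrier k (le_kn : (k <= n)%N) s :
  carrier (htpy le_kn s).1 `<=` (htpy le_kn s).2.
Proof. by case: k le_kn s => [|k] le_kn s; exact: subsetUl. Qed.

(** The set attached to a simplex contains those attached to its facets by construction;
    [is_face_ind] extends this to all faces. *)
Lemma htpy_face m k (t : sing R m Z) (s : sing R k Z) (le_mn : (m <= n)%N)
    (le_kn : (k <= n)%N) :
  is_face t s -> (htpy le_mn t).2 `<=` (htpy le_kn s).2.
Proof.
move=> ts; move: k s ts le_kn; apply: is_face_ind => [|k s i IH] le_kn.
  by rewrite (bool_irrelevance le_kn le_mn).
apply: subset_trans (IH (ltnW le_kn)) _ => x Hx.
by right; exists i.
Qed.

Lemma htpy_vertex k (v : sing R 0 Z) (s : sing R k Z) (le_kn : (k <= n)%N) :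
  is_vertex v s ->
  carrier (phi 0 (leq0n n) (chain1 v)) `|` carrier (psi 0 (leq0n n) (chain1 v))
    `<=` (htpy le_kn s).2.
Proof.
move=> vs x Hx; apply: (@htpy_face _ _ _ _ (leq0n n) le_kn vs).
by right; exact: Hx.
Qed.

Hypothesis C_refines : forall j k, (j <= k <= n.+1)%N -> refines (C j) (C k).
Hypothesis C_bounds : forall k B, (k <= n)%N -> C k B ->
  exists2 A, C k.+1 A & star (C k) B `<=` A /\ bounds_in R G k (star (C k) B) A.

(** The member in which the cycles of the star bound also contains the star, so it holds both the
    filling and [K]. *)
Lemma fillP k (z : chain R G k X) K B : (k <= n)%N -> C k B -> is_cycle z ->
  carrier z `<=` star (C k) B -> K `<=` star (C k) B ->
  bdry (fill z K).1 = z /\ exists2 A, C k.+1 A & (fill z K).2 `<=` A.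
Proof.
move=> le_kn CB z_cycle zB KB; have [A CA [BA bA]] := C_bounds le_kn CB.
have [d dA dz] := bA z z_cycle zB.
suff ex_d : exists d', bdry d' = z /\
    exists2 A, C k.+1 A & carrier d' `|` K `<=` A.
  by apply: (xgetPex 0 ex_d).
exists d; split=> //; exists A => //.
by rewrite subUset; split=> //; exact: subset_trans BA.
Qed.

Hypothesis G_nontrivial : (1 : G) != 0.
Hypothesis phi_correct : correct_morphism phi.
Hypothesis phi_psi : cover_close (C 0) phi psi.

(** Correctness makes the image of a vertex a single simplex; its points are what make members of
    the covers meet. *)
Lemma phi_vertex_nonempty (v : sing R 0 Z) :
  carrier (phi 0 (leq0n n) (chain1 v)) !=set0.
Proof. by have [t ->] := phi_correct v; exact: carrier_nonempty. Qed.

Lemma sub_star (V : set (set X)) (A B D : set X) :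
  V A -> B `&` A !=set0 -> D `<=` A -> D `<=` star V B.
Proof.
by move=> VA [x [Bx Ax]] DA y /DA Ay; exists A => //; split=> //; exists x.
Qed.

Lemma close_cover k (s : sing R k Z) (le_kn : (k <= n)%N) :
  exists2 B, C k B &
    [/\ carrier (phi k le_kn (chain1 s)) `|` carrier (psi k le_kn (chain1 s))
          `<=` star (C k) B &
        forall v, is_vertex v s ->
          carrier (phi 0 (leq0n n) (chain1 v)) `<=` B].
Proof.
have [A CA sA] := phi_psi s le_kn; have [B CB AB] : exists2 B, C k B & A `<=` B.
  by apply: C_refines CA; rewrite leqW.
have vB v : is_vertex v s -> carrier (phi 0 (leq0n n) (chain1 v)) `<=` B.
  move=> vs; apply: subset_trans AB.
  by apply: subset_trans (sA _ (leq0n n) _ vs); exact: subsetUl.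
exists B => //; split=> //.
(* [B] lies in its own star only if it is nonempty; a vertex of [s] supplies a point. *)
have [v vs] := vertex_exists s; have [x vx] := phi_vertex_nonempty v.
have Bx := vB _ vs _ vx.
apply: (sub_star CB); first by exists x.
by apply: subset_trans AB; apply: sA; exact: is_face_refl.
Qed.

(** Smallness and the homotopy equation go through one induction: for the next degree, the equation
    shows that the chain to be filled is a cycle, and smallness puts it in a star. *)
Lemma htpy_spec k (le_kn : (k <= n)%N) :
  (forall s, exists2 A, C k.+1 A & (htpy le_kn s).2 `<=` A) /\
  match k return (k <= n)%N -> Prop with
  | 0 => fun le_kn => forall s, bdry (htpy le_kn s).1 =
      phi 0 le_kn (chain1 s) - psi 0 le_kn (chain1 s)
  | k.+1 => fun le_kn => forall s, bdry (htpy le_kn s).1 =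
      phi k.+1 le_kn (chain1 s) - psi k.+1 le_kn (chain1 s)
        - htpy_map (ltnW le_kn) (bdry (chain1 s))
  end le_kn.
Proof.
elim: k le_kn => [|k IH] le_kn.
  suff fillP0 s : bdry (htpy le_kn s).1 =
        phi 0 le_kn (chain1 s) - psi 0 le_kn (chain1 s) /\
      exists2 A, C 1 A & (htpy le_kn s).2 `<=` A.
    by split=> s; have [] := fillP0 s.
  have [B CB [sB _]] := close_cover s le_kn.
  apply: (fillP le_kn CB) => //; last first.
    by move: sB; rewrite subUset => -[]; exact: carrierB.
  rewrite /is_cycle linearB (bool_irrelevance le_kn (leq0n n)).
  by rewrite !chain_mor_aug subrr.
have [small bdryH] := IH (ltnW le_kn).
suff fillPS s : bdry (htpy le_kn s).1 =
      phi k.+1 le_kn (chain1 s) - psi k.+1 le_kn (chain1 s)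
        - htpy_map (ltnW le_kn) (bdry (chain1 s)) /\
    exists2 A, C k.+2 A & (htpy le_kn s).2 `<=` A.
  by split=> s; have [] := fillPS s.
have [B CB []] := close_cover s le_kn.
rewrite subUset => -[phiB psiB] vB.
have facet_star (i : 'I_k.+2) :
    (htpy (ltnW le_kn) (sing_restr (lift i) s)).2 `<=` star (C k.+1) B.
  have [A CA iA] := small (sing_restr (lift i) s).
  (* The image under [phi] of a vertex of the facet lies in [B] by closeness and in [A] by
     construction, so [A] meets [B]. *)
  have [v vi] := vertex_exists (sing_restr (lift i) s).
  have [x vx] := phi_vertex_nonempty v.
  apply: (sub_star CA) => //; exists x; split.
    exact: vB (vertex_facet vi) _ vx.
  by apply: iA; apply: htpy_vertex vi _ _; left.
apply: (fillP le_kn CB) => //.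
- rewrite /is_cycle !linearB /= !chain_mor_bdry; apply/eqP.
  rewrite subr_eq0 eq_sym; apply/eqP.
  case: k le_kn s bdryH {IH small B CB phiB psiB vB facet_star} =>
      [|k] le_kn s bdryH.
    apply: (chain_linear_eq (f := bdry \o htpy_map (ltnW le_kn))
      (g := phi 0 (ltnW le_kn) \- psi 0 (ltnW le_kn))) => t /=.
    by rewrite htpy_map1 bdryH.
  (* Zero is rewritten as the homotopy applied to a double boundary. Both sides are then linear maps
     evaluated at [bdry (chain1 s)], and can be compared on single simplexes. *)
  rewrite -[RHS]subr0 -[X in _ - X](linear0 (htpy_map (ltnW (ltnW le_kn)))).
  rewrite -(bdry_bdry (chain1 s)).
  apply: (chain_linear_eq (f := bdry \o htpy_map (ltnW le_kn))
    (g := (phi k.+1 (ltnW le_kn) \- psi k.+1 (ltnW le_kn)) \-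
      (htpy_map (ltnW (ltnW le_kn)) \o bdry))) => t /=.
  by rewrite htpy_map1 bdryH.
- apply: carrierB; first exact: carrierB.
  apply: (carrier_bdry (f := htpy_map (ltnW le_kn))) => i; rewrite htpy_map1.
  exact: subset_trans (@htpy_carrier _ _ _) (facet_star i).
- by move=> x [i _]; exact: facet_star.
Qed.

(** The set attached to [s] contains the carriers for all its faces and vertices, so one member of
    [C k.+1], enlarged to one of [C n.+1], serves them all. *)
Lemma chain_homotopy_exists :
  exists D : degree1_map R G n Z X,
    chain_homotopy phi psi D /\ cover_small (C n.+1) phi psi D.
Proof.
exists htpy_map; split.
  split=> [s|k lt_kn s]; rewrite htpy_map1; first exact: (@htpy_spec 0 _).2.
  exact: (htpy_spec lt_kn).2.
move=> k s le_kn.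
have [A CA sA] := (htpy_spec le_kn).1 s.
have [A' UA' AA'] : exists2 A', C n.+1 A' & A `<=` A'.
  by apply: C_refines CA; rewrite ltnS le_kn leqnn.
exists A' => //; split=> [m le_mn t ts|v vs].
  rewrite htpy_map1; apply: subset_trans AA'; apply: subset_trans sA.
  apply: subset_trans (@htpy_face _ _ _ _ le_mn le_kn ts).
  exact: htpy_carrier.
by apply: subset_trans AA'; apply: subset_trans sA; exact: htpy_vertex.
Qed.

End Homotopy.

(** * Covers in whose members the cycles of stars bound *)

Lemma refines_trans (X : Type) (U V W : set (set X)) :
  refines U V -> refines V W -> refines U W.
Proof.
move=> UV VW A /UV[B /VW[D WD BD] AB]; exists D => //; exact: subset_trans BD.
Qed.

Lemma homologically_lc_cover (R : realType) (G : comPzRingType) (n : nat)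
    (X : topologicalType) (U : set (set X)) :
  paracompact X -> homologically_lc R G n X -> open_cover U ->
  exists V, [/\ open_cover V, refines V U &
    forall B, V B -> exists2 A, U A & star V B `<=` A /\
      forall k, (k <= n)%N -> bounds_in R G k (star V B) A].
Proof.
move=> pX lcX cU.
(* Local connectedness says exactly that these sets cover [X]; a star refinement then puts each star
   inside one of them. *)
pose W := [set B | open B /\ exists2 A, U A & B `<=` A /\
  forall k, (k <= n)%N -> bounds_in R G k B A].
have cW : open_cover W.
  split=> [B []//|]; apply/seteqP; split=> // x _.
  have [A UA Ax] := cover_point x cU.
  have [V [Vx [VA V0]]] := lcX x A (open_cover_nbhs cU UA Ax).
  exists V^°; last exact: Vx.
  split; first exact: open_interior.
  exists A => //; split; first by move=> z /interior_subset /VA.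
  move=> k le_kn c c_cycle cV.
  have /trivial_homologyP := V0 k le_kn; apply=> //.
  by apply: subset_trans cV _ => z /interior_subset.
have [O [oO OW]] := star_refinement pX cW.
have starO x : exists2 A, U A & star (range O) (O x) `<=` A /\
    forall k, (k <= n)%N -> bounds_in R G k (star (range O) (O x)) A.
  have [B [_ [A UA [BA bBA]]] OB] := OW x.
  have sB : star (range O) (O x) `<=` B.
    by move=> z [_ [[y _ <-] yx] Oyz]; exact: OB Oyz.
  exists A => //; split=> [|k le_kn c c_cycle cO]; first exact: subset_trans BA.
  by apply: (bBA k) => //; exact: subset_trans sB.
exists (range O); split=> [|_ [x _ <-]|_ [x _ <-]].
- split=> [_ [x _ <-]|]; first exact: (oO x).1.
  by apply/seteqP; split=> // x _; exists (O x); [exists x | exact: (oO x).2].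
- have [A UA [sA _]] := starO x; exists A => //; apply: subset_trans sA => z Oz.
  by exists (O x) => //; split; [exists x | exists z].
- exact: starO.
Qed.

(** * From small homotopies to local connectedness *)

Section Constant.
Variables (R : realType) (G : comPzRingType) (X : topologicalType) (x : X).

Definition const_map (Z : topologicalType) : continuousType Z X :=
  mkcts (@cst_continuous Z X x).

Definition const_sing k : sing R k X := const_map _.

Lemma sum_signs m : \sum_(i < m) (-1) ^+ i = (odd m)%:R :> G.
Proof.
elim: m => [|m IH]; first by rewrite big_ord0.
rewrite big_ord_recr /= IH -signr_odd.
by case: (odd m); rewrite /= ?expr1 ?expr0 ?subrr ?add0r.
Qed.

Lemma bdry_const_sing k :
  bdry (chain1 (const_sing k.+1)) = (odd k)%:R *: chain1 (const_sing k)
    :> chain R G k X.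
Proof.
(* All [k.+2] facets coincide, and [k.+2] has the parity of [k]. *)
rewrite bdry1 -[odd k]negbK -[~~ odd k]/(odd k.+1) -[~~ _]/(odd k.+2).
rewrite -sum_signs scaler_suml; apply: eq_bigr => i _; congr (_ *: chain1 _).
exact/continuousEP.
Qed.

Lemma chain_push_const (Z : topologicalType) k (c : chain R G k Z) :
  chain_push R G (const_map Z) k c =
  (\sum_(s <- msupp c) mcoeff s c) *: chain1 (const_sing k).
Proof.
rewrite scaler_suml; apply: eq_bigr => s _; congr (_ *: chain1 _).
exact/continuousEP.
Qed.

(** Reduced homology of a point. In odd degree the constant simplex is the boundary of the next one.
    In positive even degree its boundary is the previous one, and in degree 0 its augmentation is 1,
    so a cycle has coefficient 0. *)
Lemma cycle_push_const_bounds (Z : topologicalType) k (c : chain R G k Z) :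
  is_cycle c -> exists2 d, carrier d `<=` [set x] &
    bdry d = chain_push R G (const_map Z) k c.
Proof.
move=> /(is_cycle_push (const_map Z)); rewrite chain_push_const.
move: (\sum_(s <- _) _) => a.
have [k_odd _|k_even a_cycle] := boolP (odd k).
  exists (a *: chain1 (const_sing k.+1)).
    apply: carrierZ; apply: subset_trans (@carrier1 _ _ _ _ _) _.
    by move=> _ [t _ <-].
  by rewrite linearZ_LR /= bdry_const_sing k_odd scale1r.
suff -> : a = 0.
  by exists 0; [exact: carrier0 | rewrite scale0r linear0].
case: k c k_even a_cycle => [|k] c k_even.
  rewrite /is_cycle linearZ_LR [aug _]chain_extend1 => <-.
  by rewrite /GRing.scale /= mulr1.
have k_odd : odd k by move: k_even; rewrite /= negbK.
rewrite /is_cycle linearZ_LR /= bdry_const_sing k_odd scale1r.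
move=> /(congr1 (mcoeff (const_sing k))).
by rewrite chain_scaleE mcoeffUU mcoeff0 mulr1.
Qed.

End Constant.

Section PushMorphism.
Variables (R : realType) (G : comPzRingType) (n : nat).
Variables (Z X : topologicalType) (f : continuousType Z X).

Definition push_morphism : chain_morphism R G n Z X :=
  @ChainMorphism R G n Z X (fun k _ => chain_push R G f k)
    (fun k _ c => bdry_push f c) (aug_push f).

Lemma push_morphism_correct : correct_morphism push_morphism.
Proof. by move=> s; exists (sing_push f s); exact: chain_push1. Qed.

End PushMorphism.

Lemma homotopy_bdry_cycle (R : realType) (G : comPzRingType) (n : nat)
    (Z X : topologicalType) (phi psi : chain_morphism R G n Z X)
    (D : degree1_map R G n Z X) k (le_kn : (k <= n)%N) (c : chain R G k Z) :
  chain_homotopy phi psi D -> is_cycle c ->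
  bdry (D k le_kn c) = phi k le_kn c - psi k le_kn c.
Proof.
move=> [D0 DS]; case: k le_kn c => [|k] le_kn c c_cycle.
  apply: (chain_linear_eq (f := bdry \o D 0 le_kn)
    (g := phi 0 le_kn \- psi 0 le_kn)) => s /=.
  by rewrite (bool_irrelevance le_kn (leq0n n)) D0.
rewrite -[RHS]subr0 -[X in _ - X](linear0 (D k (ltnW le_kn))) -c_cycle.
apply: (chain_linear_eq (f := bdry \o D k.+1 le_kn)
  (g := (phi k.+1 le_kn \- psi k.+1 le_kn) \- (D k (ltnW le_kn) \o bdry))).
by move=> s /=; rewrite DS.
Qed.

Lemma covers_homologically_lc (R : realType) (G : comPzRingType) (n : nat)
    (X : topologicalType) :
  paracompact X ->
  (forall U : set (set X), open_cover U ->
   exists2 V : set (set X), open_cover V &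
    forall Z : topologicalType, paracompact Z ->
    forall phi psi : chain_morphism R G n Z X,
      correct_morphism phi -> correct_morphism psi ->
      cover_close V phi psi ->
      exists D : degree1_map R G n Z X,
        chain_homotopy phi psi D /\ cover_small U phi psi D) ->
  homologically_lc R G n X.
Proof.
move=> pX HX x U Ux.
have [G0|G_nontrivial] := eqVneq (1 : G) 0.
  exists U; split=> //; exists (@subset_refl _ U) => k _.
  apply/trivial_homologyP => c _ _; exists 0; first exact: carrier0.
  exact: trivial_ring_chain.
pose cov := [set U^°; ~` [set x]].
have cov_open : open_cover cov.
  split=> [_ [->|->]|].
  - exact: open_interior.
  - exact/closed_openC/accessible_closed_set1/hausdorff_accessible/pX.1.
  - apply/seteqP; split=> // y _; have [->|yx] := pselect (y = x).
      by exists U^°; [left | exact: Ux].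
    by exists (~` [set x]) => //; right.
have [V cV HV] := HX _ cov_open; have [B VB Bx] := cover_point x cV.
(* [C] is closed in order to be a paracompact domain; lying in [B], which contains [x], it makes the
   inclusion and the constant map close. *)
have [C [cC Cx]] := paracompact_closed_nbhs pX
  (filterI (open_cover_nbhs cV VB Bx) Ux).
rewrite subsetI => -[CB CU].
exists C; split=> //; exists CU => k le_kn.
apply/trivial_homologyP => c c_cycle c_C.
pose incl := push_morphism R G n (set_incl C).
pose const := push_morphism R G n (const_map x C).
have const_carrier m (s : sing R m C) :
    carrier (chain_push R G (const_map x C) m (chain1 s)) `<=` [set x].
  rewrite chain_push1; apply: subset_trans (@carrier1 _ _ _ _ _) _.
  by move=> _ [t _ <-].
have incl_const : cover_close V incl const.
  move=> m s _; exists B => // l le_ln t _; rewrite subUset; split.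
    by apply: subset_trans CB; exact: chain_push_carrier.
  by apply: subset_trans (const_carrier _ _) _ => _ ->.
have [D [D_htpy D_small]] := HV _ (paracompact_closed_subspace pX cC) incl const
  (@push_morphism_correct _ _ _ _ _ _) (@push_morphism_correct _ _ _ _ _ _)
  incl_const.
have D_U : carrier (D k le_kn (chain_corestr C k c)) `<=` U.
  apply: carrier_linear => s; have [A covA [sA vA]] := D_small k s le_kn.
  apply: subset_trans (sA _ le_kn s (is_face_refl s)) _.
  case: covA sA vA => ->; first by move=> _ _; exact: interior_subset.
  (* The complement of [x] is impossible: it would contain the carrier of the constant morphism on a
     vertex, which is nonempty and lies in [[set x]]. *)
  move=> _; have [v vs] := vertex_exists s.
  move=> /(_ v vs); rewrite subUset => -[_]; have := const_carrier _ v.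
  rewrite /const /= chain_push1; set t := sing_push _ _.
  have [y ty] := carrier_nonempty t G_nontrivial.
  by move=> /(_ y ty) yx /(_ y ty).
have c'_cycle : is_cycle (chain_corestr C k c) := is_cycle_corestr c_C c_cycle.
have [e ex eE] := cycle_push_const_bounds x c'_cycle.
(* The boundary of the first term is [c] minus the constant cycle, and [e] bounds the latter. *)
exists (D k le_kn (chain_corestr C k c) + e).
  apply: carrierD => //.
  by apply: subset_trans ex _ => _ ->; exact: nbhs_singleton.
rewrite linearD /= (homotopy_bdry_cycle _ D_htpy) //=.
by rewrite chain_corestrK // eE subrK.
Qed.

Theorem proposition4p1 (R : realType) (G : comPzRingType) (n : nat)
    (X : topologicalType) (X_paracompact : paracompact X) :
  homologically_lc R G n X <->
  forall U : set (set X), open_cover U ->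
  exists V : set (set X), [/\ open_cover V, refines V U &
    forall Z : topologicalType, paracompact Z ->
    forall phi psi : chain_morphism R G n Z X,
      correct_morphism phi -> correct_morphism psi ->
      cover_close V phi psi ->
      exists D : degree1_map R G n Z X,
        chain_homotopy phi psi D /\ cover_small U phi psi D].
Proof.
split=> [lcX U cU|HX]; last first.
  by apply: covers_homologically_lc => // U /HX[V [cV _ HV]]; exists V.
have /choice[N NP] : forall U : set (set X), exists V, open_cover U ->
    [/\ open_cover V, refines V U &
      forall B, V B -> exists2 A, U A & star V B `<=` A /\
        forall k, (k <= n)%N -> bounds_in R G k (star V B) A].
  move=> W; have [cW|ncW] := pselect (open_cover W); last by exists W.
  by have [V] := homologically_lc_cover X_paracompact lcX cW; exists V.
(* Indexed backwards from [C n.+1 = U], so that filling a [k]-cycle moves from [C k] to the coarser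
   [C k.+1]. *)
pose C k := iter (n.+1 - k) N U.
have cN m : open_cover (iter m N U).
  by elim: m => //= m /NP[].
have N_refines m p : refines (iter (p + m) N U) (iter m N U).
  elim: p => [A UA|p IH]; first by exists A.
  by apply: refines_trans IH; have [] := NP _ (cN (p + m)%N).
have C_refines j k : (j <= k <= n.+1)%N -> refines (C j) (C k).
  move=> /andP[jk kn].
  by rewrite /C (_ : n.+1 - j = (k - j) + (n.+1 - k))%N //; lia.
have C_bounds k B : (k <= n)%N -> C k B -> exists2 A, C k.+1 A &
    star (C k) B `<=` A /\ bounds_in R G k (star (C k) B) A.
  move=> le_kn; rewrite /C subSS subSn //= => CB.
  have [_ _ /(_ _ CB)[A UA [BA bA]]] := NP _ (cN (n - k)%N).
  by exists A => //; split=> //; exact: bA.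
have CU : C n.+1 = U by rewrite /C subnn.
have C0_U : refines (C 0) U by rewrite -CU; apply: C_refines; rewrite leqnn.
exists (C 0); split=> [|//|Z pZ phi psi phi_correct psi_correct phi_psi].
  exact: cN.
(* Over the zero ring carriers are empty, so smallness says nothing about the
   position of the vertices. *)
have [G0|G_nontrivial] := eqVneq (1 : G) 0; last first.
  by rewrite -CU; exact: chain_homotopy_exists phi_psi.
have carrierG0 Y k (c : chain R G k Y) A : carrier c `<=` A.
  by rewrite (trivial_ring_chain c 0 G0); exact: carrier0.
exists (fun k _ => \0); split; first by split=> *; exact: trivial_ring_chain.
move=> k s le_kn; have [B /C0_U[A UA _] _] := phi_psi k s le_kn.
exists A => //; split=> [m le_mn t _|v _]; first exact: carrierG0.
by rewrite subUset; split; exact: carrierG0.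
Qed.
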